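(* Consider the discrete-time system $\mathbf{x}^+=T(\mathbf{x})$, $T:\mathbb{R}^n\to\mathbb{R}^n$, over a bounded set $\mathcal{X}\subset\mathbb{R}^n$. Let $T$ be Lipschitz continuous with respect to the max norm, and let $L>0$ be an upper bound on its Lipschitz constant, so that $\|T(\mathbf{p})-T(\mathbf{q})\|_\infty\le L\|\mathbf{p}-\mathbf{q}\|_\infty$ for all $\mathbf{p},\mathbf{q}\in\mathcal{X}$. Let $\mathcal{D}=\{\mathbf{x}_j,\mathbf{x}_j^+\}_{j=1}^M$ be a data set with $\mathbf{x}_j\in\mathcal{X}$ and $\mathbf{x}_j^+=T(\mathbf{x}_j)$, and let $\tau>0$. Let $\mathcal{Q}$ be a tree data structure (as defined in the context) with $\bigcup_{k\in L_{\mathcal{Q}}}B_{r_k,\infty}(\mathbf{x}_k)\subseteq\mathcal{X}$. Let $\mathcal{Q}$, $L$, $\tau$ and $\mathcal{D}$ be the inputs to the procedure Synthesize (described in the context). Then Synthesize produces, in a finite number of steps, a positive invariant set $\mathcal{S}=\bigcup_{k\in L_{\mathcal{Q}}}B_{\hat r_k,\infty}(\hat{\mathbf{x}}_k)$, where $\mathcal{Q}$ is the tree at termination.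
   Context: Notation. $B_{r,\infty}(\mathbf{x})=\{\mathbf{y}\in\mathbb{R}^n:\|\mathbf{x}-\mathbf{y}\|_\infty\le r\}$. A set $\mathcal{S}$ is positive invariant for $T$ if $T^k(\mathbf{x}_0)\in\mathcal{S}$ for all $\mathbf{x}_0\in\mathcal{S}$ and all integers $k\ge 0$ (the empty set is positive invariant). Tree data structure. $\mathcal{Q}$ is a tree whose nodes are tuples $(\hat r_i,\hat{\mathbf{x}}_i,r_i,\{\mathbf{x}_i,\mathbf{x}_i^+\},s_i)$. The target radius $\hat r_i$ and target center $\hat{\mathbf{x}}_i$ define a hypercube partition $B_{\hat r_i,\infty}(\hat{\mathbf{x}}_i)\subset\mathcal{X}$; $\{\mathbf{x}_i,\mathbf{x}_i^+\}$ is a sampled state and successor from $\mathcal{D}$; $r_i$ is the radius of the tightest max-norm ball centered at $\mathbf{x}_i$ with $B_{r_i,\infty}(\mathbf{x}_i)\supseteq B_{\hat r_i,\infty}(\hat{\mathbf{x}}_i)$; the label $s_i$ says whether the partition is included in ($s_i=1$) or excluded from ($s_i=0$) a candidate positive invariant set, or has unknown status ($s_i=-1$). $L_{\mathcal{Q}}$ denotes the set of indices of the leaf nodes of $\mathcal{Q}$ with label $s=1$. The tree given as input to Synthesize has $s_i=1$ for all nodes, and its partitions are those of $\mathcal{X}$ or of an inner approximation of $\mathcal{X}$. Procedure Divide($\mathcal{Q},i,\mathcal{D}$). Adds to node $i$ a total of $2^n$ leaf nodes, one for each $\mathbf{v}\in\{1,-1\}^n$: the new node $k$ has $\hat r_k=\hat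 r_i/2$, $\hat{\mathbf{x}}_k=\hat{\mathbf{x}}_i+\hat r_k\mathbf{v}$, $\mathbf{x}_k=\arg\min_{\mathbf{x}\in\mathcal{D}}\|\hat{\mathbf{x}}_k-\mathbf{x}\|_\infty$ (over the sampled states of $\mathcal{D}$) with its successor $\mathbf{x}_k^+$, $r_k=\hat r_k+\|\hat{\mathbf{x}}_k-\mathbf{x}_k\|_\infty$, and $s_k=1$. Procedure Synthesize($\mathcal{Q},\tau,L,\mathcal{D}$). Set $z=1$, $\hat{\mathcal{S}}_1=\bigcup_{k\in L_{\mathcal{Q}}}B_{r_k,\infty}(\mathbf{x}_k)$ and $\hat{\mathcal{S}}_0=\emptyset$. While $\hat{\mathcal{S}}_z\ne\hat{\mathcal{S}}_{z-1}$, do the following. Set $\hat{\mathcal{S}}_{z+1}=\bigcup_{k\in L_{\mathcal{Q}}}B_{\hat r_k,\infty}(\hat{\mathbf{x}}_k)$. For each leaf node $i$ of $\mathcal{Q}$ with $s_i=1$, let $B^+_{r_i,\infty}(\mathbf{x}_i)=\{\mathbf{y}\in\mathbb{R}^n:\|\mathbf{x}_i^+-\mathbf{y}\|_\infty\le Lr_i\}$ and: (i) if $B^+_{r_i,\infty}(\mathbf{x}_i)\cap\hat{\mathcal{S}}_{z+1}=B^+_{r_i,\infty}(\mathbf{x}_i)$, set $s_i=1$; (ii) else if $B^+_{r_i,\infty}(\mathbf{x}_i)\cap\hat{\mathcal{S}}_{z+1}=\emptyset$, set $s_i=0$; (iii) otherwise, if $\hat r_i/2\ge\tau$, apply Divide($\mathcal{Q},i,\mathcal{D}$),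 and if $\hat r_i/2<\tau$, set $s_i=-1$. After each node, recompute $\hat{\mathcal{S}}_{z+1}=\bigcup_{k\in L_{\mathcal{Q}}}B_{\hat r_k,\infty}(\hat{\mathbf{x}}_k)$ from the current tree. After the loop over nodes, increase $z$ by one. When the while loop ends, return $\mathcal{S}=\hat{\mathcal{S}}_z$. *)

(* Defs.v *)
From HB Require Import structures.
From mathcomp Require Import all_boot all_order all_algebra.
From mathcomp Require Import all_classical all_reals all_analysis.
From Stdlib Require Export Relation_Operators.
Set Implicit Arguments.
Unset Strict Implicit.
Unset Printing Implicit Defensive.
Import Order.TTheory GRing.Theory Num.Theory.
Import numFieldNormedType.Exports.
Local Open Scope classical_set_scope.
Local Open Scope ring_scope.

(* The norm `|x| of x : 'rV[R]_n is the max norm. *)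

(* The library's closed_ball is the closure of the open ball, which is empty
   for radius 0; here a ball of radius 0 is a point. *)
Definition cball (R : realType) (n : nat) (c : 'rV[R]_n) (r : R) :
    set 'rV[R]_n :=
  closed_ball_ Num.norm c r.

Definition positive_invariant (U : Type) (T : U -> U) (S : set U) : Prop :=
  forall x0, S x0 -> forall k : nat, S (iter k T x0).

Record node (R : realType) (n : nat) := Node {
  trad : R;              (* target radius \hat r *)
  tctr : 'rV[R]_n;       (* target center \hat x *)
  rad  : R;              (* r *)
  smp  : 'rV[R]_n;       (* sampled state x *)
  succ : 'rV[R]_n;       (* sampled successor x^+ *)
  lab  : int             (* s: 1 included, 0 excluded, -1 unknown *)
}.

Definition cell (R : realType) (n : nat) (v : node R n) : set 'rV[R]_n :=
  cball (tctr v) (trad v).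

Definition set_lab (R : realType) (n : nat) (s : int) (v : node R n) :
    node R n :=
  Node (trad v) (tctr v) (rad v) (smp v) (succ v) s.

(* A tree is a table of nodes, each with the index of its parent (None for the
   root); new nodes are appended, so an index keeps denoting the same node. *)
Definition qtree (R : realType) (n : nat) := seq (option nat * node R n).

Definition entry (R : realType) (n : nat) (Q : qtree R n) (k : nat) :
    option nat * node R n :=
  nth (None, Node 0 0 0 0 0 0) Q k.

Definition parent (R : realType) (n : nat) (Q : qtree R n) (k : nat) :
    option nat := (entry Q k).1.

Definition nd (R : realType) (n : nat) (Q : qtree R n) (k : nat) : node R n :=
  (entry Q k).2.

(* Index 0 is the root and parents come before their children. *)
Definition is_tree (R : realType) (n : nat) (Q : qtree R n) : Prop :=
  (0 < size Q)%N /\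
  forall k : nat, (k < size Q)%N ->
    match parent Q k return Prop with
    | Some j => (j < k)%N
    | None => k = 0%N
    end.

Definition is_leaf (R : realType) (n : nat) (Q : qtree R n) (k : nat) : Prop :=
  (k < size Q)%N /\ forall j : nat, (j < size Q)%N -> parent Q j <> Some k.

(* L_Q *)
Definition included_leaves (R : realType) (n : nat) (Q : qtree R n) : set nat :=
  [set k | is_leaf Q k /\ lab (nd Q k) = 1].

Definition cell_union (R : realType) (n : nat) (Q : qtree R n) :
    set 'rV[R]_n :=
  \bigcup_(k in included_leaves Q) cell (nd Q k).

Definition sample_ball_union (R : realType) (n : nat) (Q : qtree R n) :
    set 'rV[R]_n :=
  \bigcup_(k in included_leaves Q) cball (smp (nd Q k)) (rad (nd Q k)).

Definition tightest_radius (R : realType) (n : nat) (v : node R n) : Prop :=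
  cell v `<=` cball (smp v) (rad v) /\
  forall r : R, cell v `<=` cball (smp v) r -> rad v <= r.

(* Pairs of the data set are (x_j, x_j^+). The cells need not cover X (inner
   approximation), and nothing is assumed about how they overlap. *)
Definition input_tree (R : realType) (n M : nat) (X : set 'rV[R]_n)
    (D : M.-tuple ('rV[R]_n * 'rV[R]_n)) (Q : qtree R n) : Prop :=
  is_tree Q /\
  forall k : nat, (k < size Q)%N ->
    [/\ cell (nd Q k) `<=` X,
        (smp (nd Q k), succ (nd Q k)) \in D,
        tightest_radius (nd Q k) &
        lab (nd Q k) = 1].

(* false stands for the sign 1, true for -1. *)
Definition sign_vec (R : realType) (n : nat) (e : {ffun 'I_n -> bool}) :
    'rV[R]_n :=
  \row_j (-1) ^+ e j.

(* p attains the arg min of |c - x| over the sampled states x; ties may be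
   broken in any way. *)
Definition nearest_sample (R : realType) (n M : nat)
    (D : M.-tuple ('rV[R]_n * 'rV[R]_n)) (c : 'rV[R]_n)
    (p : 'rV[R]_n * 'rV[R]_n) : Prop :=
  p \in D /\ forall q, q \in D -> `|c - p.1| <= `|c - q.1|.

Definition child_ctr (R : realType) (n : nat) (v : node R n)
    (e : {ffun 'I_n -> bool}) : 'rV[R]_n :=
  tctr v + (trad v / 2) *: sign_vec R e.

Definition child (R : realType) (n : nat) (v : node R n)
    (e : {ffun 'I_n -> bool}) (p : 'rV[R]_n * 'rV[R]_n) : node R n :=
  Node (trad v / 2) (child_ctr v e)
       (trad v / 2 + `|child_ctr v e - p.1|) p.1 p.2 1.

Definition divide (R : realType) (n M : nat)
    (D : M.-tuple ('rV[R]_n * 'rV[R]_n)) (Q : qtree R n) (i : nat)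
    (Q' : qtree R n) : Prop :=
  exists sel : {ffun 'I_n -> bool} -> 'rV[R]_n * 'rV[R]_n,
    (forall e, nearest_sample D (child_ctr (nd Q i) e) (sel e)) /\
    Q' = Q ++ [seq (Some i, child (nd Q i) e (sel e))
                | e <- enum {ffun 'I_n -> bool}].

Definition relabel (R : realType) (n : nat) (Q : qtree R n) (i : nat)
    (s : int) : qtree R n :=
  set_nth (None, Node 0 0 0 0 0 0) Q i (parent Q i, set_lab s (nd Q i)).

(* B^+ *)
Definition succ_ball (R : realType) (n : nat) (L : R) (v : node R n) :
    set 'rV[R]_n :=
  cball (succ v) (L * rad v).

(* Treatment of leaf i against the current candidate set S. *)
Inductive treat (R : realType) (n M : nat) (tau L : R)
    (D : M.-tuple ('rV[R]_n * 'rV[R]_n)) (Q : qtree R n) (S : set 'rV[R]_n)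
    (i : nat) : qtree R n -> Prop :=
| treat_included :
    succ_ball L (nd Q i) `&` S = succ_ball L (nd Q i) ->
    treat tau L D Q S i (relabel Q i 1)
| treat_excluded :
    succ_ball L (nd Q i) `&` S <> succ_ball L (nd Q i) ->
    succ_ball L (nd Q i) `&` S = set0 ->
    treat tau L D Q S i (relabel Q i 0)
| treat_divide (Q' : qtree R n) :
    succ_ball L (nd Q i) `&` S <> succ_ball L (nd Q i) ->
    succ_ball L (nd Q i) `&` S <> set0 ->
    tau <= trad (nd Q i) / 2 ->
    divide D Q i Q' ->
    treat tau L D Q S i Q'
| treat_unknown :
    succ_ball L (nd Q i) `&` S <> succ_ball L (nd Q i) ->
    succ_ball L (nd Q i) `&` S <> set0 ->
    trad (nd Q i) / 2 < tau ->
    treat tau L D Q S i (relabel Q i (- 1)).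

(* AtTest Q S0 S1: the test of the while loop, S0 = \hat S_{z-1} and
   S1 = \hat S_z.
   InPass Q seen S1 S2: inside the loop over nodes, S1 = \hat S_z and
   S2 = \hat S_{z+1}; seen lists the nodes treated since this loop began. *)
Inductive state (R : realType) (n : nat) :=
| AtTest (Q : qtree R n) (S0 S1 : set 'rV[R]_n)
| InPass (Q : qtree R n) (seen : seq nat) (S1 S2 : set 'rV[R]_n).

(* The loop over nodes treats leaves labelled 1 of the current tree, in any
   order, and ends when no untreated one is left. The leaves created by divide
   during the loop are thus treated in that same loop: were they left for the
   next one, a loop that only divides would leave the union unchanged and the
   procedure would return it with none of the new cells checked. *)
Inductive step (R : realType) (n M : nat) (tau L : R)
    (D : M.-tuple ('rV[R]_n * 'rV[R]_n)) : state R n -> state R n -> Prop :=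
| step_enter Q S0 S1 :
    S1 <> S0 ->
    step tau L D (AtTest Q S0 S1) (InPass Q [::] S1 (cell_union Q))
| step_node Q seen S1 S2 i Q' :
    included_leaves Q i -> i \notin seen -> treat tau L D Q S2 i Q' ->
    step tau L D (InPass Q seen S1 S2)
                 (InPass Q' (i :: seen) S1 (cell_union Q'))
| step_exit Q seen S1 S2 :
    (forall i, included_leaves Q i -> i \in seen) ->
    step tau L D (InPass Q seen S1 S2) (AtTest Q S1 S2).

Definition start (R : realType) (n : nat) (Q : qtree R n) : state R n :=
  AtTest Q set0 (sample_ball_union Q).

Definition reaches (R : realType) (n M : nat) (tau L : R)
    (D : M.-tuple ('rV[R]_n * 'rV[R]_n)) : state R n -> state R n -> Prop :=
  clos_refl_trans_1n (state R n) (step tau L D).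

Definition returns (R : realType) (n : nat) (st : state R n) (Q : qtree R n)
    (S : set 'rV[R]_n) : Prop :=
  exists S0, st = AtTest Q S0 S /\ S = S0.

(* Main.v *)
Require Import Defs.
From HB Require Import structures.
From mathcomp Require Import all_boot all_order all_algebra.
From mathcomp Require Import all_classical all_reals all_analysis.
Set Implicit Arguments.
Unset Strict Implicit.
Unset Printing Implicit Defensive.
Import Order.TTheory GRing.Theory Num.Theory.
Import numFieldNormedType.Exports.
Local Open Scope classical_set_scope.
Local Open Scope ring_scope.

(* Invariance: along a run the union of the included cells only shrinks, since
   a divided cell contains its children. Hence in a last pass, whose initial
   and final unions agree, every included leaf was checked against the returned
   set S itself, and the Lipschitz bound gives T(cell) <= B^+ <= S.
   Termination: weigh an included leaf of target radius r by
   (2^n + 1)^floor(r / tau). Giving up or dividing a leaf decreases the total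
   weight, because r / tau drops by at least 1 when r / 2 >= tau. Only finitely
   many consecutive steps leave the weight constant: they do not modify the
   tree, so the next full pass recomputes the same union and the test of the
   while loop ends the run. *)

(** * Norm estimates for balls, cells and their children *)

Section Geometry.
Context {R : realType} {n : nat}.
Implicit Types (v : node R n) (c : 'rV[R]_n) (T : 'rV[R]_n -> 'rV[R]_n).

(** An inequality only, since for [n = 0] the norm is 0. *)
Lemma norm_sign_vec_le1 (e : {ffun 'I_n -> bool}) : `|sign_vec R e| <= 1.
Proof.
rewrite [leLHS]mx_normrE; apply: bigmax_le => // -[i j] _ /=.
by rewrite mxE normr_sign.
Qed.

Lemma cball_subset (c c' : 'rV[R]_n) (r r' : R) :
  `|c' - c| + r <= r' -> cball c r `<=` cball c' r'.
Proof.
move=> h y cy; apply: le_trans h.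
rewrite -[c' - y](subrKA c); apply: le_trans (ler_normD _ _) _.
by rewrite lerD2l.
Qed.

(** The center moves by at most [trad v / 2], exactly what the radius loses. *)
Lemma cell_child_subset v e p : 0 <= trad v -> cell (child v e p) `<=` cell v.
Proof.
move=> v0; apply: cball_subset; rewrite /= /child_ctr opprD addrA subrr sub0r.
rewrite normrN normrZ ger0_norm ?divr_ge0// [leRHS]splitr lerD2r.
by rewrite ler_piMr ?divr_ge0 ?norm_sign_vec_le1.
Qed.

Lemma cell_child_sample v e p :
  cell (child v e p) `<=` cball p.1 (Defs.rad (child v e p)).
Proof. by apply: cball_subset; rewrite /= distrC addrC. Qed.

(** The Lipschitz bound holds on [X] only, so both the point [x] of the cell and the sample must lie
    in [X]. *)
Lemma lipschitz_succ_ball (X : set 'rV[R]_n) T (L : R) v x :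
  0 < L -> L.-lipschitz_X T -> cell v `<=` X -> X (smp v) ->
  succ v = T (smp v) -> cell v `<=` cball (smp v) (Defs.rad v) ->
  cell v x -> succ_ball L v (T x).
Proof.
move=> L0 TL vX sX vE vs vx; rewrite /succ_ball /cball /closed_ball_ /= vE.
apply: le_trans (TL (smp v, x) _) _; first by split => //; exact: vX.
by rewrite /= ler_pM2l//; exact: vs.
Qed.

Lemma nearest_sample_exists (M : nat) (D : M.-tuple ('rV[R]_n * 'rV[R]_n)) d c :
  d \in D -> exists p, nearest_sample D c p.
Proof.
case/tnthP => i0 _.
case: (arg_minP (fun i => `|c - (tnth D i).1|) (isT : xpredT i0)) => i _ imin.
exists (tnth D i); split; first exact: mem_tnth.
by move=> _ /tnthP[j ->]; exact: imin.
Qed.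

End Geometry.

(** * Effect of one treatment on the tree and on its weight *)

Section Trees.
Context {R : realType} {n M : nat}.
Variables (tau L : R) (D : M.-tuple ('rV[R]_n * 'rV[R]_n)).
Implicit Types (Q : qtree R n) (S : set 'rV[R]_n) (i k : nat).

Lemma included_leaf_lt Q k : included_leaves Q k -> (k < size Q)%N.
Proof. by case=> -[]. Qed.

(** The leaf already carries the label 1, so a passed inclusion test does not modify the tree. *)
Lemma relabel_included Q i : included_leaves Q i -> relabel Q i 1 = Q.
Proof.
move=> Qi; have iQ := included_leaf_lt Qi; case: Qi => _ labi.
apply: (@eq_from_nth _ (None, Node 0 0 0 0 0 0)).
  by rewrite size_set_nth; apply/maxn_idPr.
move=> k _; rewrite nth_set_nth /=; case: eqP => // ->.
rewrite /set_lab -labi /nd /parent /entry.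
by case: (nth _ _ _) => p [].
Qed.

(* The leaf i is given up, and only sub-cells of it may be added. *)
Definition shrinks Q i Q' : Prop :=
  [/\ (size Q <= size Q')%N, (size Q' <= size Q + 2 ^ n)%N &
  forall k, included_leaves Q' k ->
    [/\ included_leaves Q k, k <> i & nd Q' k = nd Q k] \/
    (size Q <= k)%N /\ exists e p,
      [/\ p \in D, tau <= trad (nd Q i) / 2 & nd Q' k = child (nd Q i) e p]].

Lemma relabel_shrinks Q i (s : int) :
  included_leaves Q i -> s <> 1 -> shrinks Q i (relabel Q i s).
Proof.
move=> Qi s1; have iQ := included_leaf_lt Qi.
have sz : size (relabel Q i s) = size Q.
  by rewrite size_set_nth; apply/maxn_idPr.
split; rewrite ?sz ?leq_addr// => k [[kQ' kleaf] labk]; left.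
have par j : parent (relabel Q i s) j = parent Q j.
  by rewrite /parent /entry nth_set_nth /=; case: eqP => // ->.
have ki : k <> i.
  by move=> ki; move: labk; rewrite ki /nd /entry nth_set_nth /= eqxx.
have ndk : nd (relabel Q i s) k = nd Q k.
  by rewrite /nd /entry nth_set_nth /=; case: eqP.
split=> //; split; last by rewrite -ndk.
split; rewrite -?sz// => j jQ; rewrite -par; exact: kleaf.
Qed.

Lemma divide_shrinks Q i Q' :
  tau <= trad (nd Q i) / 2 -> divide D Q i Q' -> shrinks Q i Q'.
Proof.
move=> tQ [sel [selP ->]]; set C := map _ _.
have sC : size C = (2 ^ n)%N.
  by rewrite size_map -cardE card_ffun card_bool card_ord.
split; rewrite ?size_cat ?sC ?leq_addr//.
move=> k [[kQ' kleaf] labk].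
have entryl j : (j < size Q)%N -> entry (Q ++ C) j = entry Q j.
  by move=> jQ; rewrite /entry nth_cat jQ.
have entryr j : (j < size C)%N -> exists e,
    entry (Q ++ C) (size Q + j)%N = (Some i, child (nd Q i) e (sel e)).
  move=> jC; rewrite /entry nth_cat ltnNge leq_addr /= addKn.
  rewrite /C size_map in jC *.
  exists (nth [ffun=> false] (enum {ffun 'I_n -> bool}) j).
  by rewrite (nth_map [ffun=> false]).
have [kQ|Qk] := ltnP k (size Q); [left|right].
  have ndk : nd (Q ++ C) k = nd Q k by rewrite /nd entryl.
  split=> //.
    split; last by rewrite -ndk.
    split=> // j jQ; rewrite /parent -entryl//; apply: kleaf.
    by rewrite size_cat ltn_addr.
  (* If [k] were [i], the first appended node would be a child of it, and [k] would not be a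
     leaf. *)
  move=> ki; have C0 : (0 < size C)%N by rewrite sC expn_gt0.
  have [e he] := entryr 0%N C0.
  apply: (kleaf (size Q + 0)%N); last by rewrite /parent he ki.
  by rewrite size_cat ltn_add2l.
split=> //.
have kC : (k - size Q < size C)%N by rewrite ltn_subLR// -size_cat.
have [e he] := entryr _ kC; exists e, (sel e).
by split=> //; [case: (selP e)|rewrite -[k](subnKC Qk) [LHS]/nd he].
Qed.

(** Invariance and termination both use only this dichotomy: a successful check, or a loss of the
    leaf. *)
Lemma treat_cases Q S i Q' : included_leaves Q i -> treat tau L D Q S i Q' ->
  (Q' = Q /\ succ_ball L (nd Q i) `<=` S) \/ shrinks Q i Q'.
Proof.
move=> Qi; case=> [QS|_ _|{}Q' _ _ tQ dQ|_ _ _].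
- by left; split; [exact: relabel_included|apply/setIidPl].
- by right; exact: relabel_shrinks.
- by right; exact: divide_shrinks.
- by right; exact: relabel_shrinks.
Qed.

Lemma treat_exists Q S i d : d \in D -> exists Q', treat tau L D Q S i Q'.
Proof.
move=> dD.
have [?|QS] := pselect (succ_ball L (nd Q i) `&` S = succ_ball L (nd Q i)).
  by eexists; exact: treat_included.
have [?|QS0] := pselect (succ_ball L (nd Q i) `&` S = set0).
  by eexists; exact: treat_excluded.
have [tQ|tQ] := leP tau (trad (nd Q i) / 2).
  have [sel selP] :=
    choice (fun e => nearest_sample_exists (child_ctr (nd Q i) e) dD).
  by eexists; apply: treat_divide => //; exists sel; split; [exact: selP|].
by eexists; exact: treat_unknown.
Qed.

Definition weight (v : node R n) : nat :=
  ((2 ^ n).+1 ^ Num.truncn (trad v / tau))%N.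

Definition potential Q : nat :=
  (\sum_(0 <= k < size Q | `[<included_leaves Q k>]) weight (nd Q k))%N.

(** With x = [trad v / 2 / tau] >= 1, [trad v / tau] = x + x >= x + 1, so the exponent of the parent
    is larger by at least 1, and the base exceeds [2 ^ n]. *)
Lemma weight_child v e p : 0 < tau -> tau <= trad v / 2 ->
  (2 ^ n * weight (child v e p) < weight v)%N.
Proof.
move=> tau0 tv; rewrite /weight /=.
have v2 : 1 <= trad v / 2 / tau by rewrite ler_pdivlMr// mul1r.
have vE : trad v / tau = trad v / 2 / tau + trad v / 2 / tau.
  by rewrite -mulrDl -splitr.
set a := Num.truncn (trad v / 2 / tau).
have av : (a < Num.truncn (trad v / tau))%N.
  rewrite truncn_gt_nat -addn1 natrD vE lerD//.
  by rewrite /a truncn_le (le_trans _ v2).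
apply: leq_trans (leq_pexp2l _ av) => //.
by rewrite expnS ltn_pmul2r// expn_gt0.
Qed.

Lemma potential_shrinks Q i Q' : 0 < tau ->
  included_leaves Q i -> shrinks Q i Q' -> (potential Q' < potential Q)%N.
Proof.
move=> tau0 Qi [QQ' Q'Q Q'P]; have iQ := included_leaf_lt Qi.
(* Old indices lose the term of [i]; it remains to show that the new ones add less than this
   term. *)
rewrite /potential (big_cat_nat _ QQ')//=.
have -> : (\sum_(0 <= k < size Q | `[<included_leaves Q k>]) weight (nd Q k) =
    \sum_(0 <= k < size Q | `[<included_leaves Q k>] && (k != i))
      weight (nd Q k) + weight (nd Q i))%N.
  rewrite !big_mkord (bigD1 (Ordinal iQ)) /=; last exact/asboolP.
  by rewrite addnC.
rewrite -addnS leq_add//.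
  rewrite big_nat_cond [leqRHS]big_nat_cond [leqRHS]big_mkcond [leqLHS]big_mkcond /=.
  apply: leq_sum => k _; case: ifP => // /andP[kQ] /asboolP /Q'P.
  case=> [[Qk /eqP ki ->]|[]]; last by rewrite leqNgt kQ.
  by rewrite kQ ki; move/asboolP: Qk => ->.
(* Below the threshold no appended node is included, and the sum over new indices is empty. *)
have [tQ|tQ] := leP tau (trad (nd Q i) / 2); last first.
  rewrite big_nat_cond big_pred0 ?expn_gt0// => k.
  apply/negbTE/negP => /andP[/andP[Qk _]] /asboolP /Q'P.
  case=> [[/included_leaf_lt]|[_ [e [p []]]]]; first by rewrite ltnNge Qk.
  by rewrite leNgt tQ.
(* The signs and the sample given here are arbitrary: the weight of a child depends only on its
   radius. *)
apply: leq_ltn_trans (weight_child [ffun=> false] 0 tau0 tQ).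
have sQ : (size Q' - size Q <= 2 ^ n)%N by rewrite leq_subLR.
apply: leq_trans (leq_mul sQ (leqnn _)).
rewrite -sum_nat_const_nat big_nat_cond [leqRHS]big_nat_cond.
rewrite [leqRHS]big_mkcond [leqLHS]big_mkcond /=.
apply: leq_sum => k _; case: ifP => // /andP[kQ /asboolP /Q'P].
rewrite kQ; case=> [[/included_leaf_lt]|[_ [e [p [_ _ ->]]]]] //.
by case/andP: kQ; rewrite leqNgt => /negbTE ->.
Qed.

Definition unseen Q (seen : seq nat) : nat :=
  (\sum_(k < size Q | `[<included_leaves Q k>] && (val k \notin seen)) 1)%N.

Lemma unseen_cons Q seen i : included_leaves Q i -> i \notin seen ->
  (unseen Q (i :: seen) < unseen Q seen)%N.
Proof.
move=> Qi iseen; have iQ := included_leaf_lt Qi.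
rewrite /unseen [ltnRHS](bigD1 (Ordinal iQ)) /=; last first.
  by rewrite iseen andbT; apply/asboolP.
rewrite add1n ltnS; apply: eq_leq; apply: eq_bigl => k.
by rewrite inE negb_or -andbA; congr (_ && _); rewrite andbC.
Qed.

End Trees.

(** Well-foundedness of the lexicographic order on pairs, by nested induction on bounds [a], [b] of
    the first values; the sequences are generalized so that they can be shifted. *)
Lemma no_lexicographic_descent (f g : nat -> nat) :
  ~ (forall t, (f t.+1 < f t)%N \/ f t.+1 = f t /\ (g t.+1 < g t)%N).
Proof.
suff H a b (f' g' : nat -> nat) : (f' 0%N <= a)%N -> (g' 0%N <= b)%N ->
    ~ (forall t, (f' t.+1 < f' t)%N \/ f' t.+1 = f' t /\ (g' t.+1 < g' t)%N).
  exact: (H (f 0%N) (g 0%N)).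
elim: a b f' g' => [|a IHa] b; elim: b => [|b IHb] f' g' fa gb dec;
  have shift t := dec t.+1; have [fl|[fe gl]] := dec 0%N.
- by have := leq_trans fl fa.
- by have := leq_trans gl gb.
- by have := leq_trans fl fa.
- apply: (IHb (f' \o succn) (g' \o succn) _ _ shift) => /=; first by rewrite fe.
  by rewrite -ltnS (leq_trans gl).
(* When [f'] drops, [g'] may jump, so its new value serves as the new bound. *)
- apply: (IHa (g' 1%N) (f' \o succn) (g' \o succn) _ _ shift) => //=.
  by rewrite -ltnS (leq_trans fl).
- by have := leq_trans gl gb.
- apply: (IHa (g' 1%N) (f' \o succn) (g' \o succn) _ _ shift) => //=.
  by rewrite -ltnS (leq_trans fl).
- apply: (IHb (f' \o succn) (g' \o succn) _ _ shift) => /=; first by rewrite fe.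
  by rewrite -ltnS (leq_trans gl).
Qed.

(** * Invariants of a run and its termination *)

Section Runs.
Context {R : realType} {n M : nat}.
Variables (X : set 'rV[R]_n) (T : 'rV[R]_n -> 'rV[R]_n) (tau L : R).
Variable D : M.-tuple ('rV[R]_n * 'rV[R]_n).
Hypotheses (L_gt0 : 0 < L) (tau_gt0 : 0 < tau) (T_lipschitz : L.-lipschitz_X T).
Hypothesis D_data : forall x xp, (x, xp) \in D -> X x /\ xp = T x.
Implicit Types (Q : qtree R n) (st : state R n).

Definition sound_leaf (v : node R n) : Prop :=
  [/\ cell v `<=` X, (smp v, succ v) \in D & cell v `<=` cball (smp v) (Defs.rad v)].

Definition sound_leaves Q : Prop :=
  forall k, included_leaves Q k -> sound_leaf (nd Q k).

Lemma shrinks_sound Q i Q' : included_leaves Q i -> shrinks tau D Q i Q' ->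
  sound_leaves Q -> sound_leaves Q'.
Proof.
move=> Qi [_ _ Q'P] QS k /Q'P[[Qk _ ->]|[_ [e [p [pD tQ ->]]]]]; first exact: QS.
have [iX _ _] := QS i Qi.
(* Nonnegativity follows from [0 < tau <= trad (nd Q i) / 2]. *)
have i0 : 0 <= trad (nd Q i).
  by rewrite -(pmulr_lge0 _ (_ : 0 < 2^-1)) ?invr_gt0// (le_trans (ltW tau_gt0)).
split; first by apply: subset_trans iX; exact: cell_child_subset.
- by rewrite -surjective_pairing.
- exact: cell_child_sample.
Qed.

Lemma shrinks_cell_union Q i Q' : included_leaves Q i -> shrinks tau D Q i Q' ->
  cell_union Q' `<=` cell_union Q.
Proof.
move=> Qi [_ _ Q'P] x [k /Q'P[[Qk _ ->]|[_ [e [p [pD tQ ->]]]]] kx].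
  by exists k.
exists i => //; apply: cell_child_subset kx.
by rewrite -(pmulr_lge0 _ (_ : 0 < 2^-1)) ?invr_gt0// (le_trans (ltW tau_gt0)).
Qed.

(** Checks are recorded against [S1], which stays fixed during a pass while [S2] shrinks. The bound
    [i < size Q] keeps treated indices apart from nodes appended later. *)
Definition run_invariant st : Prop :=
  match st with
  | AtTest Q S0 S1 =>
      [/\ sound_leaves Q, cell_union Q `<=` S1 &
          S1 = S0 -> S1 = cell_union Q /\ forall x, S1 x -> S1 (T x)]
  | InPass Q seen S1 S2 =>
      [/\ sound_leaves Q, S2 = cell_union Q, S2 `<=` S1 &
          forall i, i \in seen -> (i < size Q)%N /\
            (included_leaves Q i -> succ_ball L (nd Q i) `<=` S1)]
  end.

Lemma start_invariant Q : input_tree X D Q -> run_invariant (start Q).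
Proof.
move=> [_ QP].
have QS : sound_leaves Q.
  by move=> k /included_leaf_lt /QP[? ? []].
have cellQ : cell_union Q `<=` sample_ball_union Q.
  move=> x [k Qk kx]; exists k => //.
  by case: (QS k Qk) => _ _; exact.
(* If the initial union is empty, the loop is never entered and the empty set is returned. *)
split=> // Q0; rewrite Q0 in cellQ *; split=> //.
by apply/seteqP; split.
Qed.

Lemma step_invariant st st' :
  run_invariant st -> step tau L D st st' -> run_invariant st'.
Proof.
move=> I st_st'; case: st_st' I => {st st'}.
- by move=> Q S0 S1 S10 [QS QS1 _]; split.
- move=> Q seen S1 S2 i Q' Qi _ /(treat_cases Qi) + [QS S2Q S21 seenP].
  rewrite S2Q in S21 *.
  case=> [[-> iS2]|QQ'].
    split=> // j; rewrite inE => /predU1P[->|/seenP//].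
    split; first exact: included_leaf_lt.
    by move=> _; exact: subset_trans iS2 S21.
  have [szQ _ Q'P] := QQ'; split=> //.
  + exact: shrinks_sound Qi QQ' QS.
  + exact: subset_trans (shrinks_cell_union Qi QQ') S21.
  move=> j jseen.
  have jQ : (j < size Q)%N.
    by move: jseen; rewrite inE => /predU1P[->|/seenP[]//]; exact: included_leaf_lt.
  split; first exact: leq_trans szQ.
  (* A seen index is old, so if still included it differs from [i] and its node is unchanged. *)
  move=> /Q'P[[Qj ji ->]|[]]; last by rewrite leqNgt jQ.
  by move: jseen; rewrite inE => /predU1P[//|/seenP[_]]; exact.
- move=> Q seen S1 S2 all_seen [QS S2Q S21 seenP]; rewrite S2Q in S21 *.
  split=> // S12; split=> // x [k Qk kx]; rewrite S12.
  have [_] := seenP k (all_seen k Qk).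
  have [kX kD kc] := QS k Qk; have [smpX succE] := D_data kD.
  apply => //; exact: lipschitz_succ_ball T_lipschitz kX smpX succE kc kx.
Qed.

Lemma reaches_invariant st st' :
  reaches tau L D st st' -> run_invariant st -> run_invariant st'.
Proof.
by elim=> // x y z xy _ IH Ix; apply: IH; exact: step_invariant xy.
Qed.

Definition state_potential st : nat :=
  match st with
  | AtTest Q _ _ => potential tau Q
  | InPass Q _ _ _ => potential tau Q
  end.

(* An upper bound on the number of remaining steps if all of them leave the
   tree unchanged. *)
Definition steps_left st : nat :=
  match st with
  | AtTest Q S0 S1 =>
      if `[<S1 = S0>] then 0%N
      else if `[<S1 = cell_union Q>] then (unseen Q [::] + 2)%N
      else (unseen Q [::] + unseen Q [::] + 4)%N
  | InPass Q seen S1 S2 =>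
      if `[<S1 = cell_union Q>] then (unseen Q seen + 1)%N
      else (unseen Q [::] + unseen Q seen + 3)%N
  end.

(** On an unchanged tree a pass costs one entry, one step per unseen leaf and one exit. If [S1] is
    already the union, one pass suffices; otherwise a second is needed, whence the constants 2 and 4
    at the test, 1 and 3 inside a pass. *)
Lemma step_descent st st' : run_invariant st -> step tau L D st st' ->
  (state_potential st' < state_potential st)%N \/
  state_potential st' = state_potential st /\ (steps_left st' < steps_left st)%N.
Proof.
move=> I st_st'; case: st_st' I => {st st'}.
- move=> Q S0 S1 S10 _; right; split=> //=.
  by rewrite (asboolF S10); case: ifP => _; rewrite ltn_add2l.
- move=> Q seen S1 S2 i Q' Qi iseen /(treat_cases Qi) + _.
  case=> [[-> _]|QQ']; last by left; exact: potential_shrinks QQ'.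
  right; split=> //=; have := unseen_cons Qi iseen.
  by case: ifP => _ lt; rewrite ltn_add2r// ltn_add2l.
- move=> Q seen S1 S2 _ [_ S2Q _ _]; right; split=> //=.
  rewrite S2Q; case: asboolP => [->|S1Q].
    by rewrite asboolT// addn1.
  rewrite asboolT// (asboolF (not_eq_sym S1Q)).
  by rewrite -addnA ltn_add2l ltn_addl.
Qed.

Lemma step_exists st d : d \in D ->
  (exists Q S, returns st Q S) \/ (exists st', step tau L D st st').
Proof.
move=> dD; case: st => [Q S0 S1|Q seen S1 S2].
  have [S10|S10] := pselect (S1 = S0); first by left; exists Q, S1, S0.
  by right; eexists; exact: step_enter.
right; have [all_seen|] := pselect (forall i, included_leaves Q i -> i \in seen).
  by eexists; exact: step_exit.
move=> /existsNP[i /not_implyP[Qi /negP iseen]].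
have [Q' QQ'] := treat_exists tau L Q S2 i dD.
by eexists; exact: step_node QQ'.
Qed.

End Runs.

Theorem theorem1 (R : realType) (n M : nat)
    (X : set 'rV[R]_n) (T : 'rV[R]_n -> 'rV[R]_n) (L tau : R)
    (D : M.-tuple ('rV[R]_n * 'rV[R]_n)) (Q : qtree R n)
    (X_bounded : bounded_set X)
    (L_gt0 : 0 < L)
    (T_lipschitz : L.-lipschitz_X T)
    (D_data : forall x xp, (x, xp) \in D -> X x /\ xp = T x)
    (tau_gt0 : 0 < tau)
    (Q_input : input_tree X D Q)
    (Q_subset : sample_ball_union Q `<=` X) :
  (forall run : nat -> state R n,
      run 0%N = start Q ->
      ~ (forall t : nat, step tau L D (run t) (run t.+1))) /\
  (forall st, reaches tau L D (start Q) st ->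
      (exists Q' S, returns st Q' S) \/ (exists st', step tau L D st st')) /\
  (forall st Q' S, reaches tau L D (start Q) st -> returns st Q' S ->
      S = cell_union Q' /\ positive_invariant T S).
Proof.
have I0 := start_invariant T L Q_input.
split=> [run run0 steps|].
  have I t : run_invariant X T L D (run t).
    elim: t => [|t IH]; first by rewrite run0.
    exact: (step_invariant L_gt0 tau_gt0 T_lipschitz D_data IH (steps t)).
  apply: (@no_lexicographic_descent (state_potential tau \o run)
            (@steps_left R n \o run)) => t.
  exact: (step_descent tau_gt0 (I t) (steps t)).
split=> [st _|st Q' S Qst [S0 [stE SS0]]].
  (* The sample of the root shows that the data set is nonempty, so that a division can always pick
     a nearest sample. *)
  have [[Q0 _] QP] := Q_input.
  by have [_ dD _ _] := QP 0%N Q0; exact: step_exists dD.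
have := reaches_invariant L_gt0 tau_gt0 T_lipschitz D_data Qst I0.
rewrite stE => -[_ _ /(_ SS0)[SQ' TS]]; split=> // x Sx.
by elim=> //= k; exact: TS.
Qed.
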